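(* Let $D$ be an integral domain with quotient field $K$, and let $\mathrm{Overr}_{\mathrm{loc}}(D)$ be the set of all local overrings of $D$, regarded as a subspace of the space $\mathrm{Overr}(D)$ of all overrings of $D$ endowed with the Zariski topology. Then $\mathrm{Overr}_{\mathrm{loc}}(D)$ is a spectral space.
   Context: An overring of $D$ is a ring $T$ with $D \subseteq T \subseteq K$; $\mathrm{Overr}(D)$ is the set of all overrings of $D$. A ring is local if it has a unique maximal ideal (no Noetherian hypothesis). The Zariski topology on $\mathrm{Overr}(D)$ has as a basis of open sets the sets $\mathrm{Overr}(D[F])$, for $F$ varying among the finite subsets of $K$, where $\mathrm{Overr}(D[F])$ is the set of overrings of $D$ containing $F$ (equivalently, the sets $\mathrm{Overr}(D[x])$, $x\in K$, form a subbasis). A topological space is spectral if it is homeomorphic to $\mathrm{Spec}(R)$ with the Zariski topology for some commutative ring $R$; equivalently, it is $T_0$, quasi-compact, has a basis of quasi-compact open subspaces closed under finite intersections, and every irreducible closed subspace has a generic point. *)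

(* Defs.v *)
From HB Require Import structures.
From mathcomp Require Import all_boot all_order all_algebra.
From mathcomp Require Import all_classical all_reals all_analysis.

Set Implicit Arguments.
Unset Strict Implicit.
Unset Printing Implicit Defensive.

Import GRing.Theory.
Local Open Scope classical_set_scope.
Local Open Scope ring_scope.
Local Open Scope quotient_scope.

(* The ideals of mathcomp's ring_quotient are boolean predicates on nonzero
   rings; here the zero ring is allowed, so that the empty space is Spec 0. *)
Section Ideals.
Variable R : comPzRingType.
Implicit Types I J : set R.

Definition ideal I : Prop :=
  [/\ I 0, forall x y, I x -> I y -> I (x + y) & forall a x, I x -> I (a * x)].

Definition prime_ideal I : Prop :=
  [/\ ideal I, ~ I 1 & forall x y, I (x * y) -> I x \/ I y].

Definition maximal_ideal I : Prop :=
  [/\ ideal I, ~ I 1 & forall J, ideal J -> ~ J 1 -> I `<=` J -> J = I].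

Definition local_ring : Prop := exists! I, maximal_ideal I.

End Ideals.

Record Spec (R : comPzRingType) := MkSpec {
  spec_ideal :> set R;
  spec_prime : prime_ideal spec_ideal
}.

Section ZariskiSpec.
Variable R : comPzRingType.

HB.instance Definition _ := gen_eqMixin (Spec R).
HB.instance Definition _ := gen_choiceMixin (Spec R).

(* The complements of the sets V(E), for E an arbitrary subset of R. *)
Definition spec_open : set_system (Spec R) :=
  [set ~` [set P : Spec R | E `<=` P] | E in [set: set R]].

Let spec_openT : spec_open [set: Spec R].
Proof.
exists [set 1] => //; apply/seteqP; split=> // P _ /=.
by case: (spec_prime P) => _ P1 _ /(_ 1 erefl).
Qed.

Let spec_openI : setI_closed spec_open.
Proof.
move=> _ _ [E _ <-] [F _ <-].
exists [set z | exists x y, [/\ E x, F y & z = x * y]] => //.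
apply/seteqP; split=> P /=; last first.
  move=> [PE PF] PEF; have [_ _ Ppr] := spec_prime P.
  apply: PF => y Fy; apply: contrapT => Py.
  apply: PE => x Ex.
  by case: (Ppr x y) => //; apply: PEF; exists x, y.
have [[_ _ PM] _ _] := spec_prime P.
move=> PEF; split=> PS; apply: PEF => _ [x [y [Ex Fy ->]]].
  by rewrite mulrC; apply: PM; apply: PS.
by apply: PM; apply: PS.
Qed.

Let spec_open_bigU (I : Type) (f : I -> set (Spec R)) :
  (forall i, spec_open (f i)) -> spec_open (\bigcup_i f i).
Proof.
move=> fo; have /choice[E fE] : forall i, exists E : set R,
    ~` [set P : Spec R | E `<=` P] = f i.
  by move=> i; have [E _ <-] := fo i; exists E.
exists (\bigcup_i E i) => //; apply/seteqP; split=> P /=.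
  move=> PE; apply: contrapT => fP; apply: PE => x [i _ Eix].
  apply: contrapT => Px; apply: fP; exists i => //.
  by rewrite -fE /= => /(_ x Eix).
by move=> [i _]; rewrite -fE /= => PE PU; apply: PE => x Ex; apply: PU; exists i.
Qed.

HB.instance Definition _ :=
  isOpenTopological.Build (Spec R) spec_openT spec_openI spec_open_bigU.

End ZariskiSpec.

Definition homeomorphic (X Y : topologicalType) : Prop :=
  exists (f : X -> Y) (g : Y -> X),
    [/\ continuous f, continuous g, cancel f g & cancel g f].

Definition spectral_space (X : topologicalType) : Prop :=
  exists R : comPzRingType, homeomorphic X (Spec R).

Section Overrings.
Variable D : idomainType.
Local Notation K := {fraction D}.

Definition is_overring (T : set K) : Prop :=
  range (@tofrac D) `<=` T /\ subring_closed [in T].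

Record Overr := MkOverr {
  overr_set :> set K;
  overr_prop : is_overring overr_set
}.

HB.instance Definition _ := gen_eqMixin Overr.
HB.instance Definition _ := gen_choiceMixin Overr.

(* Overr(D[F]): an overring of D contains D[F] iff it contains F. *)
Definition overr_containing (F : seq K) : set Overr :=
  [set T : Overr | [set` F] `<=` T].

Let overr_cover : \bigcup_(F in [set: seq K]) overr_containing F = setT.
Proof. by apply/seteqP; split=> // T _; exists [::]. Qed.

Let overr_join (F G : seq K) (T : Overr) : setT F -> setT G ->
  overr_containing F T -> overr_containing G T ->
  exists H : seq K, [/\ setT H, overr_containing H T &
    overr_containing H `<=` overr_containing F `&` overr_containing G].
Proof.
move=> _ _ FT GT; exists (F ++ G); split=> //.
  by move=> x /=; rewrite mem_cat => /orP[/FT|/GT].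
by move=> S HS; split=> x /= xF; apply: HS; rewrite /= mem_cat xF ?orbT.
Qed.

(* isBaseTopological wants a pointed index type. *)
#[local] HB.instance Definition _ := isPointed.Build (seq K) [::].

HB.instance Definition _ :=
  isBaseTopological.Build Overr overr_cover overr_join.

Section OverringRing.
Variable T : Overr.

Let overr_pred : {pred K} := [in overr_set T].
Let overr_closed : subring_closed overr_pred.
Proof. by case: (overr_prop T). Qed.

HB.instance Definition _ := GRing.isSubringClosed.Build K overr_pred overr_closed.

Definition overr_ring : Type := {x : K | x \in overr_pred}.

HB.instance Definition _ := [isSub of overr_ring for @sval _ _].
HB.instance Definition _ := [Choice of overr_ring by <:].
HB.instance Definition _ := [SubChoice_isSubComNzRing of overr_ring by <:].

End OverringRing.

Definition Overr_loc : set Overr := [set T | local_ring (overr_ring T)].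

End Overrings.

Arguments Overr_loc : clear implicits.

(* Main.v *)
From HB Require Import structures.
Require Import Defs.
From mathcomp Require Import all_boot all_order all_algebra.
From mathcomp Require Import all_classical all_reals all_analysis.
From mathcomp Require Import ring.

Set Implicit Arguments.
Unset Strict Implicit.
Unset Printing Implicit Defensive.

Import Order.TTheory GRing.Theory Num.Theory.
Local Open Scope classical_set_scope.
Local Open Scope ring_scope.

(** Why the theorem holds.

An overring T is local iff, for every x in T, x or 1 - x has its inverse in T
([overr_localP]).  Like the axioms of overrings, this is a condition of the
form: finitely many memberships imply one of finitely many memberships.  Such
conditions pass to the limit {a | a \in T for U-almost all T} of an ultrafilter
U on the space X of local overrings ([overr_loc_ultralimit]), which is to say
that X is closed in the patch topology of the power set of K.  As the sets
{T | a \in T} form a subbasis of X, this makes X satisfy the topological axioms of a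
spectral space; what is needed is a ring with spectrum X.

The ring is built for any space X whose points x are determined by sets
[coords x] of indices, with the sets {x | i \in coords x} as subbasis and with
all ultrafilter limits ([spectral_of_ultralimits], a form of Hochster's
theorem).  Here y lies in the closure of x iff coords y `<=` coords x.

Let L be the field of rational functions in variables X_i, one per index, and
one more variable z.  A set S of indices defines a subfield of L, generated by
the X_i with i in S ([coefficient S]), and a discrete valuation, for which the
X_i with i outside S have value 1 and which is trivial on that subfield;
[infinitesimal S] is its maximal ideal.  The ring R consists of the functions
f : X -> L, locally constant for the patch topology, such that f x is in the
subfield of coords x and such that f x reduces to f y modulo the valuation of
coords y whenever y is in the closure of x.  The following facts give
Spec R = X, a point x being sent to the prime ideal {f | f x = 0}.

- The support (cozero set) of f is open: it is a patch-clopen set which is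
  stable under generization, because the valuation of coords y is trivial on
  the subfield in which f y lies ([cozero_mono], [open_cozero]).
- The function X_i on {x | i \in coords x}, extended by 0, is in R
  ([indicator]); so the supports form a basis, and x is determined by its prime.
- If the support of a lies in that of b then b divides a power of a
  ([spring_dvd_pow]).  The quotient a^N / b, extended by 0, has to be
  infinitesimal at the points where b degenerates to 0.  There a has positive
  value, while b takes finitely many values in L by compactness, and a given
  rational function has bounded order for all the valuations at once
  ([rescale_order]).
- The supports of elements of an ideal are directed: a + n b has the union of
  the supports of a and b, for any integer n that avoids the finitely many
  values of - a / b ([cozeroU]).

By the last two facts the sets (support of a minus support of b), for a
outside a given prime ideal P and b in it, form a filter base, and the limit of
an ultrafilter containing them is a point whose prime is P
([vanishing_surj]). *)

(** * Polynomial functions in arbitrarily many variables *)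

Section PolynomialFunctions.
Variable J : Type.

(** Polynomials over the rationals in a set J of variables, represented by the
functions they define: as the field is infinite nothing is lost, and
substitutions become compositions of functions. *)
Inductive polynomial_function : ((J -> rat) -> rat) -> Prop :=
| polyfun_const c : polynomial_function (fun=> c)
| polyfun_coord j : polynomial_function (fun u => u j)
| polyfun_sub f g : polynomial_function f -> polynomial_function g ->
    polynomial_function (fun u => f u - g u)
| polyfun_mul f g : polynomial_function f -> polynomial_function g ->
    polynomial_function (fun u => f u * g u).

Let polyfun_pred : {pred (J -> rat) -> rat} :=
  [in (polynomial_function : set _)].

Let polyfun_closed : subring_closed polyfun_pred.
Proof.
split=> [|f g|f g]; rewrite !inE; first exact: (polyfun_const 1).
  exact: polyfun_sub.
exact: polyfun_mul.
Qed.

Definition polyfun : Type := {f : (J -> rat) -> rat | f \in polyfun_pred}.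

HB.instance Definition _ := [isSub of polyfun for @sval _ _].
HB.instance Definition _ := [Choice of polyfun by <:].
HB.instance Definition _ :=
  GRing.SubChoice_isSubComPzRing.Build _ _ polyfun polyfun_closed.

Definition polyeval (p : polyfun) : (J -> rat) -> rat := val p.

Lemma polyevalP p : polynomial_function (polyeval p).
Proof. by have := valP p; rewrite inE. Qed.

Definition Polyfun f (pf : polynomial_function f) : polyfun :=
  exist _ f (mem_set pf).

Lemma polyevalK f (pf : polynomial_function f) : polyeval (Polyfun pf) = f.
Proof. by []. Qed.

Lemma polyfun_eq p q : polyeval p =1 polyeval q -> p = q.
Proof. by move=> pq; apply/val_inj/funext. Qed.

Lemma polyeval0 u : polyeval 0 u = 0. Proof. by []. Qed.
Lemma polyevalD p q u : polyeval (p + q) u = polyeval p u + polyeval q u.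
Proof. by []. Qed.
Lemma polyevalB p q u : polyeval (p - q) u = polyeval p u - polyeval q u.
Proof. by []. Qed.
Lemma polyevalM p q u : polyeval (p * q) u = polyeval p u * polyeval q u.
Proof. by []. Qed.
Lemma polyevalX p n u : polyeval (p ^+ n) u = polyeval p u ^+ n.
Proof. by elim: n => [|n IH]; rewrite ?expr0// !exprS polyevalM IH. Qed.
Lemma polyeval_natr n u : polyeval n%:R u = n%:R.
Proof. by elim: n => [|n IH]; rewrite ?mulr0n// !mulrS polyevalD IH. Qed.

Lemma polyfun_ind (P : polyfun -> Prop) :
  (forall c, P (Polyfun (polyfun_const c))) ->
  (forall j, P (Polyfun (polyfun_coord j))) ->
  (forall p q, P p -> P q -> P (p - q)) ->
  (forall p q, P p -> P q -> P (p * q)) ->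
  forall p, P p.
Proof.
move=> Pc Pj Ps Pm p; have := polyevalP p.
move: {-1}(polyeval p) (erefl (polyeval p)).
move=> f pf fP; elim: fP p pf => [c|j|g h gP IHg hP IHh|g h gP IHg hP IHh] p pE.
- by rewrite (_ : p = Polyfun (polyfun_const c)) //; apply/val_inj.
- by rewrite (_ : p = Polyfun (polyfun_coord j)) //; apply/val_inj.
- rewrite (_ : p = Polyfun gP - Polyfun hP); last exact/val_inj.
  by apply: Ps; [exact: IHg|exact: IHh].
- rewrite (_ : p = Polyfun gP * Polyfun hP); last exact/val_inj.
  by apply: Pm; [exact: IHg|exact: IHh].
Qed.

(** Lines serve both to show that these functions form a domain and, because the
bound n on the degree is the same for all lines, to bound orders of vanishing
uniformly. *)
Lemma polyfun_line p : exists n, forall u v : J -> rat,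
  exists P : {poly rat}, (size P <= n)%N /\
    forall t, polyeval p (fun j => u j + t * v j) = P.[t].
Proof.
elim/polyfun_ind: p => [c|j|p q [m pP] [n qP]|p q [m pP] [n qP]].
- exists 1 => u v; exists c%:P; split=> [|t]; last by rewrite hornerC.
  exact: size_polyC_leq1.
- exists 2 => u v; exists ((v j)%:P * 'X + (u j)%:P); split=> [|t].
    by rewrite size_MXaddC; case: ifP => // _; rewrite ltnS size_polyC_leq1.
  by rewrite polyevalK !hornerE addrC mulrC.
- exists (maxn m n) => u v; have [P [Pm PE]] := pP u v.
  have [Q [Qn QE]] := qP u v; exists (P - Q); split=> [|t].
    rewrite (leq_trans (size_polyD _ _))// size_polyN.
    by rewrite geq_max !leq_max Pm Qn orbT.
  by rewrite polyevalB PE QE !hornerE.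
- exists (m + n)%N => u v; have [P [Pm PE]] := pP u v.
  have [Q [Qn QE]] := qP u v; exists (P * Q); split=> [|t].
    rewrite (leq_trans (size_polyMleq _ _))// (leq_trans (leq_pred _))//.
    exact: leq_add.
  by rewrite polyevalM PE QE !hornerE.
Qed.

Lemma poly_rat_eq0 (P : {poly rat}) : (forall t, P.[t] = 0) -> P = 0.
Proof.
move=> P0; apply/eqP/negPn/negP => Pn0.
have := @max_poly_roots _ P [seq i%:R | i <- iota 0 (size P)] Pn0.
rewrite size_map size_iota ltnn => absurd; suff: false by []; apply: absurd.
  by apply/allP => t _; rewrite rootE P0.
rewrite map_inj_uniq ?iota_uniq// => i j /eqP.
by rewrite eqr_nat => /eqP.
Qed.

Lemma polyfun_neq0P p : p != 0 <-> exists u, polyeval p u != 0.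
Proof.
split=> [p0|[u]]; last by apply: contra => /eqP ->.
apply: contrapT => pu; move/eqP: p0; apply; apply/polyfun_eq => u.
by rewrite polyeval0; apply/eqP/negPn/negP => pu0; apply: pu; exists u.
Qed.

(** Two nonzero functions are nonzero at points u and v respectively; neither
vanishes identically on the line through u and v, hence nor does their
product. *)
Lemma polyfun_mulf_eq0 (p q : polyfun) : p * q = 0 -> (p == 0) || (q == 0).
Proof.
move=> pq; rewrite -[_ || _]negbK negb_or; apply/negP => /andP[].
move=> /polyfun_neq0P[u pu] /polyfun_neq0P[v qv].
have [_ /(_ u (fun j => v j - u j))[P [_ PE]]] := polyfun_line p.
have [_ /(_ u (fun j => v j - u j))[Q [_ QE]]] := polyfun_line q.
have /eqP : P * Q = 0.
  by apply: poly_rat_eq0 => t; rewrite hornerM -PE -QE -polyevalM pq.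
rewrite mulf_eq0 => /orP[]/eqP E0.
  have := PE 0; rewrite E0 horner0 => pu0; move/eqP: pu; apply.
  by rewrite -[RHS]pu0; congr polyeval; apply/funext => j; rewrite mul0r addr0.
have := QE 1; rewrite E0 horner0 => qv0; move/eqP: qv; apply.
by rewrite -[RHS]qv0; congr polyeval; apply/funext => j; rewrite mul1r subrKC.
Qed.

Let polyfun_neq0 : 1 != 0 :> polyfun.
Proof.
by apply/eqP => /(congr1 (fun p => polyeval p (fun=> 0)))/eqP; rewrite oner_eq0.
Qed.

HB.instance Definition _ :=
  GRing.PzSemiRing_isNonZero.Build polyfun polyfun_neq0.

Let polyfun_unit : pred polyfun := fun p => `[< exists q, q * p = 1 >].
Let polyfun_inv (p : polyfun) : polyfun :=
  if pselect (exists q, q * p = 1) is left e then projT1 (cid e) else p.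

Let polyfun_mulVx : {in polyfun_unit, left_inverse 1 polyfun_inv *%R}.
Proof.
move=> p /asboolP e; rewrite /polyfun_inv; case: pselect => // e'.
by case: cid.
Qed.

Let polyfun_unitPl x y : y * x = 1 -> polyfun_unit x.
Proof. by move=> yx; apply/asboolP; exists y. Qed.

Let polyfun_invr_out : {in [predC polyfun_unit], polyfun_inv =1 id}.
Proof.
move=> p /negP np; rewrite /polyfun_inv; case: pselect => // e.
by case: np; apply/asboolP.
Qed.

HB.instance Definition _ := GRing.ComNzRing_hasMulInverse.Build polyfun
  polyfun_mulVx polyfun_unitPl polyfun_invr_out.

HB.instance Definition _ :=
  GRing.ComUnitRing_isIntegral.Build polyfun polyfun_mulf_eq0.

End PolynomialFunctions.

Lemma fraction_ofP (R : idomainType) (x : {fraction R}) :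
  exists p q : R, q != 0 /\ x = tofrac p / tofrac q.
Proof.
elim/quotW: x => -[[p q] /= q0]; exists p, q; split=> //.
apply: (@mulIf _ (tofrac q)); first by rewrite tofrac_eq0.
rewrite divfK ?tofrac_eq0//.
rewrite !piE; apply/eqP.
rewrite FracField.equivf_def /FracField.mulf /=.
rewrite !numden_Ratio ?mulf_neq0 ?oner_neq0//.
by rewrite !mulr1 mulrC.
Qed.

(** * A field with a family of discrete valuations *)

Section Scaling.
Variable I : Type.
Implicit Types (S : set I) (u v : option I -> rat).
Implicit Types p q r s : polyfun (option I).

(** The point u has a coordinate [u None], the parameter z, and a coordinate
[u (Some i)] per index i.  Composition with [scale S] substitutes z X_i for the
variables X_i with i outside S; the valuation attached to S is the order in z
after this substitution. *)
Definition scale S u (o : option I) : rat :=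
  if o is Some i then (if `[< S i >] then u o else u None * u o) else u None.

Definition kill_param u (o : option I) : rat := if o is Some _ then u o else 0.

Let scale_polyfun S p : polynomial_function (fun u => polyeval p (scale S u)).
Proof.
elim/polyfun_ind: p => [c|[i|]|p q pP qP|p q pP qP].
- exact: polyfun_const.
- have [Si|/asboolPn Si] := pselect (S i); rewrite polyevalK/= ?Si.
    by rewrite asboolT//; exact: polyfun_coord.
  by rewrite (negbTE Si); apply: polyfun_mul; exact: polyfun_coord.
- exact: polyfun_coord.
- exact: polyfun_sub.
- exact: polyfun_mul.
Qed.

Let kill_polyfun p : polynomial_function (fun u => polyeval p (kill_param u)).
Proof.
elim/polyfun_ind: p => [c|[i|]|p q pP qP|p q pP qP].
- exact: polyfun_const.
- exact: polyfun_coord.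
- exact: polyfun_const.
- exact: polyfun_sub.
- exact: polyfun_mul.
Qed.

Definition rescale S p := Polyfun (scale_polyfun S p).
Definition residue p := Polyfun (kill_polyfun p).

Lemma rescaleE S p u : polyeval (rescale S p) u = polyeval p (scale S u).
Proof. by []. Qed.

Let rescale_zmod_morphism S : zmod_morphism (rescale S).
Proof. by move=> p q; apply/polyfun_eq. Qed.
Let rescale_monoid_morphism S : monoid_morphism (rescale S).
Proof. by split=> [|p q]; apply/polyfun_eq. Qed.
HB.instance Definition _ S :=
  GRing.isZmodMorphism.Build _ _ (rescale S) (rescale_zmod_morphism S).
HB.instance Definition _ S :=
  GRing.isMonoidMorphism.Build _ _ (rescale S) (rescale_monoid_morphism S).

Let residue_zmod_morphism : zmod_morphism residue.
Proof. by move=> p q; apply/polyfun_eq. Qed.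
Let residue_monoid_morphism : monoid_morphism residue.
Proof. by split=> [|p q]; apply/polyfun_eq. Qed.
HB.instance Definition _ :=
  GRing.isZmodMorphism.Build _ _ residue residue_zmod_morphism.
HB.instance Definition _ :=
  GRing.isMonoidMorphism.Build _ _ residue residue_monoid_morphism.

Definition coordinate (o : option I) := Polyfun (polyfun_coord o).
Local Notation z := (coordinate None).

Lemma coordinate_neq0 o : coordinate o != 0.
Proof. by apply/polyfun_neq0P; exists (fun=> 1); rewrite oner_neq0. Qed.

Lemma residue_param : residue z = 0.
Proof. exact/polyfun_eq. Qed.

(** Thus p is divisible by z iff [residue p] is zero, and z is a prime. *)
Lemma residue_decomposition p : exists q, p = residue p + z * q.
Proof.
elim/polyfun_ind: p => [c|[i|]|p q [p' pE] [q' qE]|p q [p' pE] [q' qE]].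
- by exists 0; rewrite mulr0 addr0; apply/polyfun_eq.
- by exists 0; rewrite mulr0 addr0; apply/polyfun_eq.
- by exists 1; rewrite mulr1 -/z residue_param add0r.
- by exists (p' - q'); rewrite rmorphB {1}pE {1}qE; ring.
- exists (residue p * q' + p' * residue q + z * p' * q').
  by rewrite rmorphM {1}pE {1}qE; ring.
Qed.

(** The order is bounded by the degree of p on lines: [t |-> scale S (u t)] is a
line when only the parameter [u t None = t] varies.  That the bound does not
depend on S is what makes the exponent in [infinitesimal_pow_div] uniform. *)
Lemma rescale_order p : p != 0 -> exists n, forall S, exists e q,
  [/\ (e < n)%N, rescale S p = z ^+ e * q & residue q != 0].
Proof.
move=> p0; have [n pn] := polyfun_line p.
have dvd_lt S m q : rescale S p = z ^+ m * q -> (m < n)%N.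
  move=> pE.
  have /polyfun_neq0P[w] : p * z != 0 by rewrite mulf_neq0// coordinate_neq0.
  rewrite polyevalM mulf_eq0 negb_or => /andP[pw w0].
  pose c := w None; rewrite polyevalK -/c in w0.
  (* The line is chosen so that [scale S (u c) = w], where p is nonzero. *)
  pose base o := if o is Some i then if `[< S i >] then w o else 0 else 0.
  pose dir o := if o is Some i then if `[< S i >] then 0 else w o / c else 1.
  pose u t o := if o is Some i then if `[< S i >] then w o else w o / c else t.
  have scaleu t : scale S (u t) = (fun o => base o + t * dir o).
    apply/funext => -[i|]; rewrite /scale/base/dir/u/=; last by rewrite mulr1 add0r.
    by case: `[< S i >]; rewrite ?mulr0 ?addr0 ?add0r.
  have [P [Pn PE]] := pn base dir.
  have [_ /(_ (u 0) (fun o => if o is None then 1 else 0))[Q [_ QE]]] :=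
    polyfun_line q.
  have uE t : u t = (fun o => u 0 o + t * (if o is None then 1 else 0)).
    apply/funext => -[i|]; first by rewrite mulr0 addr0.
    by rewrite mulr1 add0r.
  have PQ : P = Q * 'X^m.
    apply/eqP; rewrite -subr_eq0; apply/eqP/poly_rat_eq0 => t.
    rewrite hornerD hornerN hornerM hornerXn -PE -QE -scaleu -uE -rescaleE pE.
    by rewrite polyevalM polyevalX mulrC subrr.
  have Q0 : Q != 0.
    apply: contraNneq pw => Q0; apply/eqP.
    have <- : P.[c] = polyeval p w; last by rewrite PQ Q0 mul0r horner0.
    rewrite -PE -scaleu; congr polyeval; apply/funext => -[i|] //=.
    by case: `[< S i >] => //; rewrite mulrC divfK.
  apply: leq_trans Pn; rewrite PQ size_mulXn//.
  by rewrite -[X in (X < _)%N]addn0 ltn_add2l size_poly_gt0.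
exists n => S.
(* Divide by z as long as possible, at most n times. *)
suff H k e q : (n <= e + k)%N -> rescale S p = z ^+ e * q ->
    exists e' q', [/\ (e' < n)%N, rescale S p = z ^+ e' * q' & residue q' != 0].
  by apply: (H n 0%N (rescale S p)); rewrite ?add0n// expr0 mul1r.
elim: k e q => [|k IH] e q nek pE.
  by have := dvd_lt _ _ _ pE; rewrite ltnNge -[e]addn0 nek.
have [q0|q0] := eqVneq (residue q) 0; last first.
  by exists e, q; split=> //; exact: dvd_lt pE.
have [q' qE] := residue_decomposition q.
apply: (IH e.+1 q'); first by rewrite addSnnS.
by rewrite pE qE q0 add0r mulrA exprSr.
Qed.

Lemma rescale_neq0 S p : p != 0 -> rescale S p != 0.
Proof.
move=> /rescale_order[n /(_ S)[e [q [_ -> q0]]]].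
rewrite mulf_neq0// ?expf_neq0 ?coordinate_neq0//.
by apply: contraNneq q0 => ->; rewrite rmorph0.
Qed.

Definition depends_only_on S p := forall u v,
  (forall i, S i -> u (Some i) = v (Some i)) -> polyeval p u = polyeval p v.

Lemma rescale_id S p : depends_only_on S p -> rescale S p = p.
Proof.
move=> pS; apply/polyfun_eq => u; apply: pS => i Si.
by rewrite /scale asboolT.
Qed.

Lemma residue_id S p : depends_only_on S p -> residue p = p.
Proof. by move=> pS; apply/polyfun_eq => u; apply: pS => i Si. Qed.

Lemma depends_only_onB S p q :
  depends_only_on S p -> depends_only_on S q -> depends_only_on S (p - q).
Proof.
by move=> pS qS u v uv; rewrite !polyevalB (pS u v)// (qS u v).
Qed.

Lemma depends_only_onM S p q :
  depends_only_on S p -> depends_only_on S q -> depends_only_on S (p * q).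
Proof.
by move=> pS qS u v uv; rewrite !polyevalM (pS u v)// (qS u v).
Qed.

Local Notation L := {fraction polyfun (option I)}.
Local Notation "p %:F" := (@tofrac (polyfun (option I))  p).
Implicit Types x y a b : L.

(** The subfield generated by the X_i with i in S: a polynomial function that
depends only on these coordinates is a polynomial in them. *)
Definition coefficient S x := exists p q,
  [/\ depends_only_on S p, depends_only_on S q, q != 0 & x = p%:F / q%:F].

(** The elements x of positive value: after rescaling, x = p / q becomes
z r / s with s prime to z. *)
Definition infinitesimal S x := exists p q r s,
  [/\ q != 0, x = p%:F / q%:F, residue s != 0 &
      rescale S p * s = z * r * rescale S q].

Lemma coefficient_poly S p : depends_only_on S p -> coefficient S p%:F.
Proof.
move=> pS; exists p, 1; split=> //; first exact: oner_neq0.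
by rewrite tofrac1 divr1.
Qed.

Lemma coefficient1 S : coefficient S 1.
Proof. by rewrite -tofrac1; exact: coefficient_poly. Qed.

Lemma coefficientB S x y :
  coefficient S x -> coefficient S y -> coefficient S (x - y).
Proof.
move=> [p [q [pS qS q0 ->]]] [p' [q' [p'S q'S q'0 ->]]].
exists (p * q' - p' * q), (q * q'); split; rewrite ?mulf_neq0//.
- by apply: depends_only_onB; exact: depends_only_onM.
- exact: depends_only_onM.
by rewrite -mulNr addf_div ?tofrac_eq0// mulNr tofracB !tofracM.
Qed.

Lemma coefficientM S x y :
  coefficient S x -> coefficient S y -> coefficient S (x * y).
Proof.
move=> [p [q [pS qS q0 ->]]] [p' [q' [p'S q'S q'0 ->]]].
exists (p * p'), (q * q'); split; rewrite ?mulf_neq0//.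
- exact: depends_only_onM.
- exact: depends_only_onM.
by rewrite mulf_div ?tofracM.
Qed.

Lemma coefficientV S x : coefficient S x -> coefficient S x^-1.
Proof.
move=> [p [q [pS qS q0 ->]]]; have [->|p0] := eqVneq p 0.
  by rewrite tofrac0 mul0r invr0 -tofrac0; apply: coefficient_poly.
by exists q, p; split=> //; rewrite invf_div.
Qed.

Lemma coefficientX S x n : coefficient S x -> coefficient S (x ^+ n).
Proof.
move=> xS; elim: n => [|n IH]; first exact: coefficient1.
by rewrite exprS; exact: coefficientM.
Qed.

Lemma infinitesimal_poly S p r : rescale S p = z * r -> infinitesimal S p%:F.
Proof.
move=> pE; exists p, 1, r, 1; split; rewrite ?oner_neq0// ?rmorph1 ?oner_neq0//.
  by rewrite divr1.
by rewrite pE.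
Qed.

Lemma infinitesimal0 S : infinitesimal S 0.
Proof.
by rewrite -tofrac0; apply: (@infinitesimal_poly _ _ 0); rewrite rmorph0 mulr0.
Qed.

Lemma infinitesimalD S x y :
  infinitesimal S x -> infinitesimal S y -> infinitesimal S (x + y).
Proof.
move=> [p [q [r [s [q0 -> s0 E]]]]] [p' [q' [r' [s' [q'0 -> s'0 E']]]]].
exists (p * q' + p' * q), (q * q'), (r * s' + r' * s), (s * s').
split; rewrite ?rmorphM ?mulf_neq0//.
  by rewrite addf_div ?tofrac_eq0// tofracD !tofracM.
rewrite !rmorphD !rmorphM/=.
rewrite (_ : _ * _ = (rescale S p * s) * s' * rescale S q' +
   (rescale S p' * s') * s * rescale S q); last by ring.
by rewrite E E'; ring.
Qed.

Lemma infinitesimalM S x y :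
  infinitesimal S x -> infinitesimal S y -> infinitesimal S (x * y).
Proof.
move=> [p [q [r [s [q0 -> s0 E]]]]] [p' [q' [r' [s' [q'0 -> s'0 E']]]]].
exists (p * p'), (q * q'), (r * z * r'), (s * s').
split; rewrite ?rmorphM ?mulf_neq0//=.
  by rewrite mulf_div ?tofracM.
by rewrite mulrACA E E'; ring.
Qed.

Lemma infinitesimal_coefM S x y :
  coefficient S x -> infinitesimal S y -> infinitesimal S (x * y).
Proof.
move=> [p [q [pS qS q0 ->]]] [p' [q' [r [s [q'0 -> s0 E]]]]].
exists (p * p'), (q * q'), (p * r), (q * s).
split; rewrite ?rmorphM ?mulf_neq0//= ?(residue_id qS)//.
  by rewrite mulf_div ?tofracM.
rewrite (rescale_id pS) (rescale_id qS) mulrACA E.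
by ring.
Qed.

Lemma infinitesimalN S x : infinitesimal S x -> infinitesimal S (- x).
Proof.
rewrite -mulN1r; apply: infinitesimal_coefM.
rewrite -[-1]sub0r; apply: coefficientB; last exact: coefficient1.
by rewrite -(subrr 1); apply: coefficientB; exact: coefficient1.
Qed.

(** An element 1 + y with y infinitesimal is a unit of the valuation ring. *)
Lemma infinitesimal_div1D S x y : infinitesimal S x -> infinitesimal S y ->
  1 + y != 0 /\ infinitesimal S (x / (1 + y)).
Proof.
move=> [p [q [r [s [q0 -> s0 E]]]]] [p' [q' [r' [s' [q'0 -> s'0 E']]]]].
have yE : 1 + p'%:F / q'%:F = (p' + q')%:F / q'%:F.
  by rewrite tofracD mulrDl divff ?tofrac_eq0// addrC.
have E1 : rescale S (p' + q') * s' = (z * r' + s') * rescale S q'.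
  by rewrite rmorphD mulrDl E'; ring.
have unit0 : residue (z * r' + s') != 0.
  by rewrite rmorphD rmorphM/= residue_param mul0r add0r.
have pq0 : p' + q' != 0.
  apply: contraNneq unit0 => pq0; move: E1.
  rewrite pq0 rmorph0 mul0r => /esym/eqP.
  rewrite mulf_eq0 (negbTE (rescale_neq0 _ q'0)) orbF => /eqP ->.
  by rewrite rmorph0.
rewrite yE; split; first by rewrite mulf_neq0 ?invr_eq0 ?tofrac_eq0.
exists (p * q'), (q * (p' + q')), (r * s'), (s * (z * r' + s')).
split; rewrite ?mulf_neq0//.
- by rewrite invf_div mulf_div !tofracM.
- by rewrite rmorphM mulf_neq0.
rewrite !rmorphM/= (_ : _ * _ = (rescale S p * s) *
  ((z * r' + s') * rescale S q')); last by ring.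
by rewrite E -E1; ring.
Qed.

(** Rescaling fixes the numerator and the denominator of a coefficient, and they
do not involve z: a nonzero coefficient has value 0. *)
Lemma coefficient_infinitesimal_eq0 S x :
  coefficient S x -> infinitesimal S x -> x = 0.
Proof.
move=> [p [q [pS qS q0 ->]]] [p' [q' [r [s [q'0 xE s0 E]]]]].
have pqE : p * q' = p' * q.
  apply/eqP; rewrite -tofrac_eq !tofracM -eqr_div ?tofrac_eq0//.
  exact/eqP.
have : p * s = z * r * q.
  apply: (mulfI (rescale_neq0 S q'0)).
  transitivity (rescale S (p * q') * s).
    by rewrite rmorphM/= (rescale_id pS); ring.
  rewrite pqE rmorphM/= (rescale_id qS) mulrAC E; ring.
move=> /(congr1 residue); rewrite !rmorphM/= residue_param !mul0r => /eqP.
rewrite mulf_eq0 (negbTE s0) orbF (residue_id pS) => /eqP ->.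
by rewrite tofrac0 mul0r.
Qed.

(** The N-th power of an infinitesimal has value at least N, and n bounds the
order of the numerator of b for all S. *)
Lemma infinitesimal_pow_div b : b != 0 -> exists n, forall N S a,
  (n <= N)%N -> infinitesimal S a -> infinitesimal S (a ^+ N / b).
Proof.
have [b1 [b2 [b20 ->]]] := fraction_ofP b.
rewrite mulf_eq0 invr_eq0 !tofrac_eq0 (negbTE b20) orbF => b10.
have [n bn] := rescale_order b10.
exists n => N S _ nN [p [q [r [s [q0 -> s0 E]]]]].
have [e [c [en bE c0]]] := bn S.
exists (p ^+ N * b2), (q ^+ N * b1).
exists (z ^+ (N - e.+1) * r ^+ N * rescale S b2), (s ^+ N * c).
split; rewrite ?mulf_neq0 ?expf_neq0//.
- by rewrite expr_div_n invf_div mulf_div !tofracM !tofracXn.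
- by rewrite rmorphM rmorphXn mulf_neq0 ?expf_neq0.
rewrite !rmorphM !rmorphXn/= mulrACA -exprMn E bE !exprMn.
have -> : z ^+ N = z * z ^+ (N - e.+1) * z ^+ e.
  rewrite -exprS -exprD; congr (_ ^+ _); rewrite addSnnS subnK//.
  exact: leq_trans en nN.
by ring.
Qed.

End Scaling.

(** * The ring attached to a space with ultrafilter limits *)

Section FieldIdentities.
Variable F : fieldType.
Implicit Types a b c d : F.

Lemma subrB_split a b c d : (a - b) - (c - d) = (a - c) - (b - d).
Proof. by ring. Qed.

Lemma mulrB_split a b c d :
  a * b - c * d = d * (a - c) + c * (b - d) + (a - c) * (b - d).
Proof. by ring. Qed.

Lemma divrB_split a b c d : d != 0 -> 1 + d^-1 * (b - d) != 0 ->
  a / b - c / d =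
  d^-1 * (((a - c) - c * (d^-1 * (b - d))) / (1 + d^-1 * (b - d))).
Proof.
set m := d^-1 * (b - d) => d0 m0; have bE : b = d * (1 + m) by rewrite /m; field.
by move: m m0 bE => m m0 ->; field; rewrite m0.
Qed.

End FieldIdentities.

Section SpringRing.
Variables (X I : Type) (coords : X -> set I).
Local Notation L := {fraction polyfun (option I)}.
Implicit Types (U : set_system X) (x y : X).

Definition ultralimit U x := forall i, coords x i <-> U [set y | coords y i].

(** Local constancy for the patch topology, whose convergent ultrafilters are
described by [ultralimit]. *)
Definition ultracontinuous T (f : X -> T) := forall U x,
  UltraFilter U -> ultralimit U x -> U [set y | f y = f x].

Lemma ultracontinuous_comp2 T1 T2 T' (h : T1 -> T2 -> T') f g :
  ultracontinuous f -> ultracontinuous g ->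
  ultracontinuous (fun x => h (f x) (g x)).
Proof.
move=> fc gc U x UU Ux; have ? := @ultra_proper _ _ UU.
by apply: filterS2 (fc U x UU Ux) (gc U x UU Ux) => y /= -> ->.
Qed.

Definition spring_function (f : X -> L) := [/\ ultracontinuous f,
  forall x, coefficient (coords x) (f x) &
  forall x y, coords y `<=` coords x -> infinitesimal (coords y) (f x - f y)].

Let spring_pred : {pred X -> L} := [in (spring_function : set _)].

Let spring_closed : subring_closed spring_pred.
Proof.
split=> [|f g|f g]; rewrite !inE.
- split=> [U x UU _|x|x y _]; last by rewrite subrr; exact: infinitesimal0.
    by have ? := @ultra_proper _ _ UU; apply: filterS filterT => y.
  exact: coefficient1.
- move=> [fc fk fi] [gc gk gi]; split=> [|x|x y yx].
  + exact: (@ultracontinuous_comp2 _ _ _ (fun a b => a - b)).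
  + exact: coefficientB.
  + rewrite (_ : _ - _ = (f x - f y) + - (g x - g y)).
      by apply: infinitesimalD (fi _ _ yx) (infinitesimalN (gi _ _ yx)).
    exact: subrB_split.
- move=> [fc fk fi] [gc gk gi]; split=> [|x|x y yx].
  + exact: (@ultracontinuous_comp2 _ _ _ (fun a b => a * b)).
  + exact: coefficientM.
  + have := (fi _ _ yx, gi _ _ yx); rewrite !fctE.
    move: (f x) (f y) (g x) (g y) (fk y) (gk y) => a a' b b' a'k b'k [ai bi].
    rewrite (_ : _ - _ = b' * (a - a') + a' * (b - b') + (a - a') * (b - b')).
      apply: infinitesimalD; last exact: infinitesimalM.
      by apply: infinitesimalD; exact: infinitesimal_coefM.
    exact: mulrB_split.
Qed.

Definition spring_ring : Type := {f : X -> L | f \in spring_pred}.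

HB.instance Definition _ := [isSub of spring_ring for @sval _ _].
HB.instance Definition _ := [Choice of spring_ring by <:].
HB.instance Definition _ :=
  GRing.SubChoice_isSubComPzRing.Build _ _ spring_ring spring_closed.

Definition springval (f : spring_ring) : X -> L := val f.

Lemma springvalP f : spring_function (springval f).
Proof. by have := valP f; rewrite inE. Qed.

Definition Spring f (sf : spring_function f) : spring_ring :=
  exist _ f (mem_set sf).

Lemma spring_eq f g : springval f =1 springval g -> f = g.
Proof. by move=> fg; apply/val_inj/funext. Qed.

Implicit Types f g a b : spring_ring.

Lemma springval1 x : springval 1 x = 1. Proof. by []. Qed.
Lemma springvalD f g x : springval (f + g) x = springval f x + springval g x.
Proof. by []. Qed.
Lemma springvalM f g x : springval (f * g) x = springval f x * springval g x.
Proof. by []. Qed.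
Lemma springvalX f n x : springval (f ^+ n) x = springval f x ^+ n.
Proof. by elim: n => [|n IH]; rewrite ?expr0// !exprS springvalM IH. Qed.
Lemma springval_natr n x : springval n%:R x = n%:R.
Proof. by elim: n => [|n IH]; rewrite ?mulr0n// !mulrS springvalD IH. Qed.

Definition cozero f : set X := [set x | springval f x != 0].

(** Were f x = 0, the coefficient f y would be infinitesimal. *)
Lemma cozero_mono f x y : coords y `<=` coords x -> cozero f y -> cozero f x.
Proof.
have [_ fk fi] := springvalP f => yx; apply: contra => /eqP fx.
have := fi _ _ yx; rewrite fx sub0r => /infinitesimalN; rewrite opprK => fy.
by apply/eqP; exact: coefficient_infinitesimal_eq0 (fk y) fy.
Qed.

Let indicator_spring i : spring_function
  (fun x => if `[< coords x i >] then tofrac (coordinate (Some i)) else 0).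
Proof.
split=> [U x UU Ux|x|x y yx].
- have ? := @ultra_proper _ _ UU.
  have [xi|xi] := pselect (coords x i).
    apply: filterS (proj1 (Ux i) xi) => y yi /=; rewrite !asboolT//.
  have [/Ux//|] := in_ultra_setVsetC [set y | coords y i] UU.
  by apply: filterS => y yi /=; rewrite !asboolF.
- case: asboolP => [xi|_]; last first.
    by rewrite -(subrr 1); apply: coefficientB; exact: coefficient1.
  by apply: coefficient_poly => u v uv; rewrite !polyevalK uv.
- have [yi|yi] := asboolP (coords y i).
    by rewrite asboolT; [rewrite subrr; exact: infinitesimal0|exact: yx].
  case: asboolP => xi; rewrite subr0; last exact: infinitesimal0.
  apply: (@infinitesimal_poly _ _ _ (coordinate (Some i))).
  by apply/polyfun_eq => u; rewrite rescaleE polyevalM !polyevalK/= asboolF.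
Qed.

Definition indicator i := Spring (indicator_spring i).

Lemma cozero_indicator i : cozero (indicator i) = [set x | coords x i].
Proof.
apply/seteqP; split=> x; rewrite /cozero/springval/=; case: asboolP => //.
  by rewrite eqxx.
by rewrite tofrac_eq0 coordinate_neq0.
Qed.

Hypothesis ultralimit_ex : forall U, UltraFilter U -> exists x, ultralimit U x.

(** If f had infinitely many values, the complements of finite unions of fibres
would be contained in an ultrafilter, along which f avoids its value at the
limit. *)
Lemma ultracontinuous_finite T (f : X -> T) :
  ultracontinuous f -> finite_set (range f).
Proof.
move=> fc; apply: contrapT => finf.
pose F : set_system X := [set A | finite_set (f @` (~` A))].
have FF : ProperFilter F.
  apply: Build_ProperFilter_ex.
    move=> A AF; apply: contrapT => A0; apply: finf.
    apply: sub_finite_set AF; apply: image_subset => x _ Ax.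
    by apply: A0; exists x.
  split=> [|A B AF BF|A B AB].
  - by rewrite /F/= setCT image_set0.
  - by rewrite /F/= setCI image_setU finite_setU.
  - by apply: sub_finite_set; apply: image_subset; exact: subsetC.
have [U [UU FU]] := ultraFilterLemma FF.
have [x Ux] := ultralimit_ex UU; have ? := @ultra_proper _ _ UU.
have nU : U [set y | f y <> f x].
  apply: FU; apply: (@sub_finite_set _ _ [set f x]); last exact: finite_set1.
  by move=> _ [y /contrapT ? <-].
have : U set0.
  by apply: filterS2 (fc U x UU Ux) nU => y.
exact: filter_not_empty.
Qed.

Lemma fraction_natr_inj : injective (fun n => n%:R : L).
Proof.
move=> m n /eqP; rewrite -!(rmorph_nat (@tofrac _)) tofrac_eq => /eqP.
move=> /(congr1 (fun p => polyeval p (fun=> 0))) /eqP.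
by rewrite !polyeval_natr eqr_nat => /eqP.
Qed.

(** Only the finitely many values of - a / b have to be avoided by n. *)
Lemma cozeroU a b : exists n,
  cozero (a + n%:R * b) = cozero a `|` cozero b.
Proof.
have [n nr] : exists n,
    ~ range (fun x => - (springval a x / springval b x)) n%:R.
  apply: contrapT => rn; apply: infinite_nat.
  have -> : [set: nat] = (fun n => n%:R : L) @^-1`
      range (fun x => - (springval a x / springval b x)).
    apply/seteqP; split=> // n _ /=.
    by apply: contrapT => ?; apply: rn; exists n.
  apply: finite_preimage.
    by move=> m n _ _; exact: fraction_natr_inj.
  apply: ultracontinuous_finite.
  apply: (@ultracontinuous_comp2 _ _ _ (fun c d => - (c / d))
    (springval a) (springval b)).
    by have [] := springvalP a.
  by have [] := springvalP b.
exists n; apply/seteqP; split=> x.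
  rewrite /cozero/= springvalD springvalM => ab.
  apply: contrapT => /not_orP[/negP/negPn/eqP a0 /negP/negPn/eqP b0].
  by move: ab; rewrite a0 b0 mulr0 addr0 eqxx.
rewrite /cozero/= springvalD springvalM springval_natr => abx.
apply/eqP => ab0; have [b0|b0] := eqVneq (springval b x) 0.
  by move: ab0 abx; rewrite b0 mulr0 addr0 => ->; rewrite eqxx => -[].
apply: nr; exists x => //; apply: (mulIf b0).
by rewrite mulNr divfK//; apply/eqP; rewrite eqr_oppLR -addr_eq0 ab0.
Qed.

Lemma spring_pow_div b : exists n, forall N x S (y : L), (n <= N)%N ->
  cozero b x -> infinitesimal S y -> infinitesimal S (y ^+ N / springval b x).
Proof.
have [bc _ _] := springvalP b.
have /finite_seqP[s sE] := ultracontinuous_finite bc.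
pose good v n := forall N S (y : L), (n <= N)%N -> infinitesimal S y ->
  infinitesimal S (y ^+ N / v).
have /choice[e eP] : forall v : L, exists n, v != 0 -> good v n.
  move=> v; have [->|v0] := eqVneq v 0; first by exists 0%N.
  by have [n nv] := infinitesimal_pow_div v0; exists n.
exists (\max_(v <- s) e v)%N => N x S y eN bx.
apply: eP => //; apply: leq_trans eN.
apply: leq_bigmax_seq => //.
by have : range (springval b) (springval b x) by []; rewrite sE.
Qed.

(** The quotient a^N / b, extended by 0 outside the support of b (as inverses of
0 are 0), is in the ring.  Where b y = 0 also a y = 0, so that a x is
infinitesimal and N can be chosen by [spring_pow_div]; where b y <> 0, both
b x and b y are units of the valuation ring and reduction commutes with
division. *)
Lemma spring_dvd_pow a b : cozero a `<=` cozero b ->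
  exists N c, a ^+ N = b * c.
Proof.
move=> ab; have [n nP] := spring_pow_div b; pose N := n.+1.
have N0 : (0 : L) ^+ N = 0 by rewrite expr0n.
have [[ac ak ai] [bc bk bi]] := (springvalP a, springvalP b).
suff sf : spring_function (fun x => springval a x ^+ N / springval b x).
  exists N, (Spring sf); apply/spring_eq => x; rewrite springvalX springvalM.
  have -> : springval (Spring sf) x = springval a x ^+ N / springval b x by [].
  rewrite mulrC.
  have [b0|b0] := eqVneq (springval b x) 0; last by rewrite divfK.
  have -> : springval a x = 0.
    by apply/eqP/negPn/negP => /ab; rewrite /cozero/= b0 eqxx.
  by rewrite N0 mul0r mul0r.
split=> [|x|x y yx].
- exact: (@ultracontinuous_comp2 _ _ _ (fun c d => c ^+ N / d)
    (springval a) (springval b)).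
- by apply: coefficientM; [exact: coefficientX|exact: coefficientV].
have [b0|b0] := eqVneq (springval b y) 0.
  have a0 : springval a y = 0.
    by apply/eqP/negPn/negP => /ab; rewrite /cozero/= b0 eqxx.
  have := ai _ _ yx; rewrite a0 subr0 N0 mul0r subr0 => aix.
  have [bx0|bx0] := eqVneq (springval b x) 0; last exact: nP.
  by rewrite bx0 invr0 mulr0; exact: infinitesimal0.
have [_ _ aNi] := springvalP (a ^+ N); have := aNi _ _ yx; rewrite !springvalX.
have := bi _ _ yx; have := coefficientX N (ak y); have := coefficientV (bk y).
move: (_ ^+ N) (_ ^+ N) (springval b x) (springval b y) b0.
move=> c' c d' d d0 dk ck di ci; pose m := d^-1 * (d' - d).
have mi : infinitesimal (coords y) m by exact: infinitesimal_coefM.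
have ni : infinitesimal (coords y) (c' - c - c * m).
  by apply: infinitesimalD => //; apply/infinitesimalN/infinitesimal_coefM.
have [m0 qi] := infinitesimal_div1D ni mi.
rewrite (divrB_split c' c d0 m0).
exact: infinitesimal_coefM.
Qed.

End SpringRing.

(** * The spectrum of the ring *)

Section Spectrum.
Variables (X : topologicalType) (I : eqType) (coords : X -> set I).
Local Notation R := (spring_ring coords).

Definition basic (s : seq I) : set X :=
  [set x | forall i, i \in s -> coords x i].

Hypothesis coords_inj : injective coords.
Hypothesis open_basic : forall O : set X,
  open O <-> forall x, O x -> exists s, basic s x /\ basic s `<=` O.
Hypothesis ultralimit_ex :
  forall U, UltraFilter U -> exists x, ultralimit coords U x.

(** If no basic neighbourhood of x were contained in the support of f, an
ultrafilter containing the basic neighbourhoods of x and the zero set of f would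
have a limit y with f y = 0 and coords x `<=` coords y, against
[cozero_mono]. *)
Lemma open_cozero (f : R) : open (cozero f).
Proof.
apply/open_basic => x fx; apply: contrapT => nos.
pose D : set (seq I) := [set s | basic s x].
pose B s := basic s `\` cozero f.
have FB : ProperFilter (filter_from D B).
  apply: filter_from_proper => [|s sx].
    apply: filter_from_filter => [|s t sx tx]; first by exists [::].
    exists (s ++ t) => [i|y [sty fy]].
      by rewrite mem_cat => /orP[/sx|/tx].
    by split; (split; last exact: fy) => i ist; apply: sty;
      rewrite mem_cat ist ?orbT.
  apply: contrapT => Bs; apply: nos; exists s; split=> [|y sy]; first exact: sx.
  by apply: contrapT => fy; apply: Bs; exists y; split; [exact: sy|exact: fy].
have [U [UU FU]] := ultraFilterLemma FB; have ? := @ultra_proper _ _ UU.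
have [y Uy] := ultralimit_ex UU.
have xy : coords x `<=` coords y.
  move=> i xi; apply/Uy; apply: FU; exists [:: i].
    by move=> j; rewrite inE => /eqP ->.
  by move=> w [+ _]; apply; rewrite inE.
have fy := cozero_mono xy fx.
have [fc _ _] := springvalP f.
have Uf : U (~` cozero f) by apply: FU; exists [::] => // w [].
suff : U set0 by exact: filter_not_empty.
apply: filterS2 (fc U y UU Uy) Uf => w /= fw; apply.
by rewrite /cozero/= fw.
Qed.

Let vanishing_prime x : prime_ideal [set f : R | springval f x = 0].
Proof.
split.
- split=> [//|f g /= f0 g0|f g /= g0]; first by rewrite springvalD f0 g0 addr0.
  by rewrite springvalM g0 mulr0.
- by move=> /eqP; rewrite springval1 oner_eq0.
- move=> f g /=; rewrite springvalM => /eqP.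
  by rewrite mulf_eq0 => /orP[]/eqP; [left|right].
Qed.

Definition vanishing x : Spec R := MkSpec (vanishing_prime x).

Lemma vanishingE x f : (vanishing x : set R) f <-> springval f x = 0.
Proof. by []. Qed.

Lemma spec_eq (A : comPzRingType) (P Q : Spec A) :
  (P : set A) = (Q : set A) -> P = Q.
Proof.
case: P Q => [P hP] [Q hQ] /= PQ; subst Q.
by congr MkSpec; exact: Prop_irrelevance.
Qed.

Lemma prime_ideal_exp (A : comPzRingType) (P : set A) a n :
  prime_ideal P -> P (a ^+ n) -> P a.
Proof.
move=> [_ P1 PM]; elim: n => [/P1//|n IH]; rewrite exprS.
by move=> /PM[|/IH].
Qed.

(** A limit x of an ultrafilter that contains the support of each a outside P
and the zero set of each b in P satisfies a x <> 0 and b x = 0, by local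
constancy. *)
Lemma vanishing_surj (P : Spec R) : exists x, vanishing x = P.
Proof.
have Pprime := spec_prime P; have [[P0 PD PM] P1 Pmul] := Pprime.
pose D : set (R * R) := [set ab | ~ (P : set R) ab.1 /\ (P : set R) ab.2].
pose B (ab : R * R) := cozero ab.1 `\` cozero ab.2.
have FB : ProperFilter (filter_from D B).
  apply: filter_from_proper => [|[a b] [/= Pa Pb]].
    apply: filter_from_filter => [|[a b] [a' b'] [/= Pa Pb] [/= Pa' Pb']].
      by exists (1, 0).
    have [n bE] := cozeroU ultralimit_ex b b'.
    exists (a * a', b + n%:R * b'); first split=> /=.
    - by move=> /Pmul[].
    - by apply: PD => //; exact: PM.
    - move=> y []; rewrite bE /cozero/= springvalM mulf_eq0.
      move=> /norP[ay a'y] /not_orP[yb yb'].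
      by split; [split; [exact: ay|exact: yb]|split; [exact: a'y|exact: yb']].
  apply: contrapT => ab0.
  have /(spring_dvd_pow ultralimit_ex)[N [c E]] : cozero a `<=` cozero b.
    by move=> y ay; apply: contrapT => yb; apply: ab0; exists y; split;
      [exact: ay|exact: yb].
  apply/Pa/(prime_ideal_exp (n := N) Pprime); rewrite E mulrC; exact: PM.
have [U [UU FU]] := ultraFilterLemma FB; have ? := @ultra_proper _ _ UU.
have [x Ux] := ultralimit_ex UU; exists x; apply/spec_eq/seteqP; split=> f.
  move=> /vanishingE fx; apply: contrapT => Pf.
  have [fc _ _] := springvalP f.
  have Uf : U (cozero f) by apply: FU; exists (f, 0) => // w [].
  suff : U set0 by exact: filter_not_empty.
  apply: filterS2 (fc U x UU Ux) Uf => w /= fw.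
  by rewrite /cozero/= fw fx eqxx.
move=> Pf; apply/vanishingE; apply/eqP/negPn/negP => fx.
have [fc _ _] := springvalP f.
have Uf : U (~` cozero f) by apply: FU; exists (1, f) => // w [].
suff : U set0 by exact: filter_not_empty.
apply: filterS2 (fc U x UU Ux) Uf => w /= fw; apply.
by rewrite /cozero/= fw.
Qed.

Lemma vanishing_inj : injective vanishing.
Proof.
move=> x y /(congr1 (@spec_ideal _)) /seteqP[xy yx]; apply: coords_inj.
have E i u : coords u i <-> ~ (vanishing u : set R) (indicator coords i).
  have -> : coords u i = cozero (indicator coords i) u.
    by rewrite cozero_indicator.
  by rewrite vanishingE; split=> [/eqP|/eqP].
apply/seteqP; split=> i /E ui; apply/E => vi; apply: ui.
  exact: yx.
exact: xy.
Qed.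

Lemma basic_cozero s : exists f : R, cozero f = basic s.
Proof.
elim: s => [|i s [f fs]].
  exists 1; apply/seteqP; split=> x _; last first.
    by rewrite /cozero/= springval1 oner_neq0.
  by move=> i; rewrite in_nil.
exists (indicator coords i * f); apply/seteqP; split=> x.
  rewrite /cozero/= springvalM mulf_eq0 => /norP[xi xf] j.
  rewrite inE => /orP[/eqP ->|]; last first.
    by move: j; change (basic s x); rewrite -fs.
  by have := xi : cozero (indicator coords i) x; rewrite cozero_indicator.
move=> xis; rewrite /cozero/= springvalM mulf_neq0//.
  change (cozero (indicator coords i) x); rewrite cozero_indicator.
  by apply: xis; rewrite mem_head.
change (cozero f x); rewrite fs => j js; apply: xis.
by rewrite inE js orbT.
Qed.

(** A form of Hochster's theorem: every spectral space satisfies the hypotheses,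
with its quasi-compact open sets as indices. *)
Theorem spectral_of_ultralimits : spectral_space X.
Proof.
have /choice[g gK] := vanishing_surj.
have vK : cancel vanishing g by move=> x; apply: vanishing_inj; rewrite gK.
exists R, vanishing, g; split.
- apply/continuousP => _ [E _ <-].
  have -> : vanishing @^-1` (~` [set P : Spec R | E `<=` P]) =
            \bigcup_(f in E) cozero f.
    apply/seteqP; split=> x /=.
      move=> Ex; apply: contrapT => xE; apply: Ex => f Ef /=.
      by apply/eqP/negPn/negP => fx; apply: xE; exists f.
    by move=> [f Ef fx] xE; move/eqP: fx; apply; exact: xE.
  by apply: bigcup_open => f _; exact: open_cozero.
- apply/continuousP => O /open_basic Oo.
  exists [set f : R | cozero f `<=` O] => //.
  apply/seteqP; split=> P; rewrite -(gK P); move: (g P) => x /=; rewrite vK.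
    move=> Ex; apply: contrapT => Ox; apply: Ex => f fO /=.
    by apply/eqP/negPn/negP => /fO.
  move=> /Oo[s [sx sO]]; have [f fs] := basic_cozero s.
  move=> /(_ f); rewrite /= fs => /(_ sO) fx; move: sx; rewrite -fs.
  by rewrite /cozero/= fx eqxx.
- exact: vK.
- exact: gK.
Qed.

End Spectrum.

(** * Local rings *)

Section LocalRings.
Variable A : comPzRingType.
Implicit Types (J M : set A) (x y : A).

Lemma maximal_ideal_above J :
  ideal J -> ~ J 1 -> exists M, maximal_ideal M /\ J `<=` M.
Proof.
move=> idJ J1; pose proper M := [/\ ideal M, ~ M 1 & J `<=` M].
(* The union of the empty chain is empty, hence the extra case. *)
have [|M [MP Mmax]] := @Zorn_bigcup A [set M | M = set0 \/ proper M].
  move=> F Fproper Ftot.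
  have [|/existsNP[N /not_implyP[FN N0]]] := pselect (forall M, F M -> M = set0).
    by move=> F0; left; apply/seteqP; split=> // x [M /F0 ->].
  have properP M x : F M -> M x -> proper M.
    by move=> /Fproper[->|].
  have [[N0' NDl NM] N1 JN] : proper N by case: (Fproper _ FN).
  right; split=> [||x /JN Nx]; last by exists N.
    split=> [|x y [M FM Mx] [M' FM' My]|a x [M FM Mx]]; first by exists N.
      have [[_ MD _] _ _] := properP _ _ FM Mx.
      have [[_ M'D _] _ _] := properP _ _ FM' My.
      have [MM'|M'M] := Ftot _ _ FM FM'.
        by exists M' => //; apply: M'D => //; exact: MM'.
      by exists M => //; apply: MD => //; exact: M'M.
    by have [[_ _ MM] _ _] := properP _ _ FM Mx; exists M => //; exact: MM.
  by move=> [M FM M1]; have [_ /(_ M1)] := properP _ _ FM M1.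
have Mproper : proper M.
  case: MP => // M0; have [] := Mmax J; last by right; split=> // x.
  split; first by rewrite M0.
  by rewrite M0 => J0; case: idJ => /J0.
have [idM M1 JM] := Mproper; exists M; split=> //; split=> // N idN N1 MN.
apply: contrapT => NM; apply: (Mmax N).
  by split=> // NM'; apply: NM; apply/seteqP.
by right; split=> // x /JM /MN.
Qed.

(** If x and 1 - x were both nonunits of a local ring, they would lie in its
maximal ideal, and so would their sum 1; conversely the condition makes the set
of nonunits an ideal, which then contains every proper ideal. *)
Lemma local_ringP : 1 != 0 :> A ->
  local_ring A <->
  forall x, (exists y, y * x = 1) \/ (exists y, y * (1 - x) = 1).
Proof.
move=> A10; split=> [[M [[idM M1 _] Muniq]] x|locA].
  have nonunit y : ~ (exists z, z * y = 1) -> M y.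
    move=> yN; have idy : ideal [set a * y | a in setT].
      split=> [|_ _ [a _ <-] [b _ <-]|a _ [b _ <-]].
      - by exists 0 => //; rewrite mul0r.
      - by exists (a + b) => //; rewrite mulrDl.
      - by exists (a * b) => //; rewrite mulrA.
    have [|N [Nmax yMN]] := maximal_ideal_above idy.
      by move=> [z _ zy]; apply: yN; exists z.
    by rewrite (Muniq _ Nmax); apply: yMN; exists 1 => //; rewrite mul1r.
  have [ux|/nonunit Mx] := pselect (exists y, y * x = 1); first by left.
  right; apply: contrapT => /nonunit M1x; apply: M1.
  by have [_ MD _] := idM; rewrite -(subrK x 1); exact: MD.
pose N : set A := [set x | ~ exists y, y * x = 1].
have N1 : ~ N 1 by apply; exists 1; rewrite mul1r.
have idN : ideal N.
  split=> [[y]|x y Nx Ny [u]|a x Nx [u ux]].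
  - by rewrite mulr0 => /esym/eqP; rewrite (negbTE A10).
  - rewrite mulrDr => uxy.
    have uy : 1 - u * x = u * y by rewrite -uxy addrAC subrr add0r.
    have [[t tx]|[t]] := locA (u * x).
      by apply: Nx; exists (t * u); rewrite -mulrA.
    by rewrite uy => ty; apply: Ny; exists (t * u); rewrite -mulrA.
  - by apply: Nx; exists (u * a); rewrite -mulrA.
have subN M : ideal M -> ~ M 1 -> M `<=` N.
  by move=> [_ _ MM] M1 x Mx [y yx]; apply: M1; rewrite -yx; exact: MM.
exists N; split=> [|M [idM M1 Mmax]]; last exact: Mmax (subN _ idM M1).
split=> // M idM M1 NM; apply/seteqP; split=> //; exact: subN.
Qed.

End LocalRings.

(** * The space of local overrings *)

Section LocalOverrings.
Variable D : idomainType.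
Local Notation K := {fraction D}.
Implicit Types T : Overr D.

Lemma overr1 T : (T : set K) 1.
Proof. by have [_ [/set_mem]] := overr_prop T. Qed.
Lemma overrB T x y : (T : set K) x -> (T : set K) y -> (T : set K) (x - y).
Proof.
by have [_ [_ TB _]] := overr_prop T => Tx Ty; apply/set_mem/TB; apply/mem_set.
Qed.
Lemma overrM T x y : (T : set K) x -> (T : set K) y -> (T : set K) (x * y).
Proof.
by have [_ [_ _ TM]] := overr_prop T => Tx Ty; apply/set_mem/TM; apply/mem_set.
Qed.

Lemma overr_unitP T (x : overr_ring T) :
  (exists y, y * x = 1) <-> val x != 0 /\ (T : set K) (val x)^-1.
Proof.
split=> [[y /(congr1 val)]|[x0 Tx]].
  rewrite rmorphM rmorph1 /= => yx.
  have x0 : val x != 0.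
    by apply/eqP => x0; move/eqP: yx; rewrite x0 mulr0 eq_sym oner_eq0.
  split=> //; have -> : (val x)^-1 = val y by apply: (mulIf x0); rewrite yx mulVf.
  exact/set_mem/valP.
exists (exist _ (val x)^-1 (mem_set Tx)); apply/val_inj.
by rewrite rmorphM rmorph1 /= mulVf.
Qed.

(** As 0^-1 = 0, the element x = 0 satisfies the first alternative without being
a unit; but then 1 - x is one.  Similarly for x = 1 and the second. *)
Lemma overr_localP T : local_ring (overr_ring T) <->
  forall x, (T : set K) x -> (T : set K) x^-1 \/ (T : set K) (1 - x)^-1.
Proof.
rewrite local_ringP ?oner_neq0//; split=> [locT x Tx|locT x].
  by case: (locT (exist _ x (mem_set Tx))) => /overr_unitP[_]; [left|right].
have Tx : (T : set K) (val x) by exact/set_mem/valP.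
have [x0|x0] := eqVneq (val x) 0.
  right; exists 1; rewrite mul1r; apply/val_inj.
  by rewrite rmorphB rmorph1 /= x0 subr0.
have [x1|x1] := eqVneq (val x) 1.
  by left; exists 1; rewrite mul1r; apply/val_inj; rewrite /= x1.
case: (locT _ Tx) => [|]; [left|right]; apply/overr_unitP => //.
by rewrite rmorphB rmorph1 subr_eq0 eq_sym.
Qed.

Lemma overr_eq (T T' : Overr D) : (T : set K) = T' -> T = T'.
Proof.
case: T T' => [T hT] [T' hT'] /= TT'; subst T'.
by congr MkOverr; exact: Prop_irrelevance.
Qed.

Lemma open_overr (O : set (Overr D)) : open O <->
  forall T, O T -> exists F : seq K,
    overr_containing F T /\ overr_containing F `<=` O.
Proof.
split=> [[Fs _ <-] T [F FsF FT]|OT].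
  by exists F; split=> // T' FT'; exists F.
exists [set F | overr_containing F `<=` O] => //.
apply/seteqP; split=> [T [F FO /FO]//|T /OT[F [FT FO]]].
by exists F.
Qed.

Definition overr_loc_set (T : set_type (Overr_loc D)) : set K := val T.

Lemma open_overr_loc (O : set (set_type (Overr_loc D))) : open O <->
  forall X, O X -> exists F : seq K,
    basic overr_loc_set F X /\ basic overr_loc_set F `<=` O.
Proof.
split=> [[W /open_overr Wo <-] T /Wo[F [FT FW]]|OT].
  by exists F; split=> // T' /FW.
exists (\bigcup_(F in [set F | basic overr_loc_set F `<=` O]) overr_containing F).
  apply/open_overr => T [F FO FT]; exists F; split=> // T' FT'.
  by exists F.
apply/seteqP; split=> [T [F FO /FO]//|T /OT[F [FT FO]]].
by exists F.
Qed.

(** An ultrafilter that contains a union of two sets contains one of them, so the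
disjunction in [overr_localP] passes to the limit. *)
Lemma overr_loc_ultralimit U : UltraFilter U ->
  exists X, ultralimit overr_loc_set U X.
Proof.
move=> UU; have ? := @ultra_proper _ _ UU.
pose V : set K := [set a | U [set X | overr_loc_set X a]].
have Vover : is_overring V.
  split=> [_ [d _ <-]|].
    apply: filterS filterT => T _; have [+ _] := overr_prop (val T).
    by apply; exists d.
  split=> [|x y|x y].
  - by apply/mem_set; apply: filterS filterT => T _; exact: overr1.
  - move=> /set_mem Vx /set_mem Vy; apply/mem_set.
    by apply: filterS2 Vx Vy => T; exact: overrB.
  - move=> /set_mem Vx /set_mem Vy; apply/mem_set.
    by apply: filterS2 Vx Vy => T; exact: overrM.
have Vloc : Overr_loc D (MkOverr Vover).
  apply/overr_localP => x Vx.
  have [|nVx] := in_ultra_setVsetC [set X | overr_loc_set X x^-1] UU.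
    by left.
  right; apply: filterS2 Vx nVx => T Tx nTx.
  by have /overr_localP/(_ _ Tx)[] := set_mem (valP T).
by exists (exist (fun T => T \in Overr_loc D) _ (mem_set Vloc)).
Qed.

End LocalOverrings.

Theorem corollary2p14 (D : idomainType) :
  spectral_space (set_type (Overr_loc D)).
Proof.
apply: (@spectral_of_ultralimits _ _ (@overr_loc_set D)).
- by move=> T T' TT'; apply/val_inj/overr_eq.
- exact: open_overr_loc.
- exact: overr_loc_ultralimit.
Qed.
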